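(* Let $\vdash$ be an algebraizable logic with equivalent algebraic semantics the quasivariety $\mathbf{Y}$, and let $f$ be a selector term. Every $\mathsf{PAt}$-$f$-logic $\vdash_s$ (relative to $\vdash$) is complete with respect to its corresponding $\mathsf{PAt}$-$f$-quasivariety, i.e. for every pair $(\Gamma,\phi)$ with $\Gamma\cup\{\phi\}\subseteq Tm(\mathcal{L},\mathsf{Prop})$: $$\Gamma\vdash_s\phi \iff \mathsf{QVar}^f(\vdash_s)\vDash_f(\Gamma,\phi).$$
   Context: Let $\mathcal{L}$ be an algebraic language (function symbols with arities), $\mathsf{Prop}$ a fixed countably infinite set of variables, $Tm(\mathcal{L},\mathsf{Prop})$ the set of terms (also called formulas). A consequence relation on a set $C$ is a relation between subsets of $C$ and elements of $C$ that is reflexive ($W\vdash a$ if $a\in W$) and satisfies cut (if $W\vdash v$ for all $v\in V$ and $V\vdash a$ then $W\vdash a$); all consequence relations are assumed finitary (if $W\vdash a$ then $V\vdash a$ for some finite $V\subseteq W$). A logic is a consequence relation on $Tm(\mathcal{L},\mathsf{Prop})$ that is invariant under substitutions (endomorphisms of the term algebra). $\Lambda(\vdash)$ is the complete lattice of (finitary) logics extending $\vdash$. A quasivariety is a class of algebras closed under isomorphisms, subalgebras and reduced products. For a class $\mathbf{K}$, $\Theta\vDash_{\mathbf{K}}\gamma\approx\delta$ means that every assignment into an algebra of $\mathbf{K}$ satisfying all equations in $\Theta$ satisfies $\gamma\approx\delta$. The logic $\vdash$ is algebraizable with equivalent algebraic semantics the quasivariety $\mathbf{Y}$ (of language $\mathcal{L}$),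 witnessed by a finite set $\mu(x)$ of equations in one variable and a finite set $\Delta(x,y)$ of formulas in two variables: (1) $\Gamma\vdash\phi$ iff $\mu[\Gamma]\vDash_{\mathbf{Y}}\mu(\phi)$; (2) $\Theta\vDash_{\mathbf{Y}}\gamma\approx\delta$ iff $\Delta[\Theta]\vdash\Delta(\gamma,\delta)$; (3) $\phi\dashv\vdash\Delta[\mu(\phi)]$; (4) $\gamma\approx\delta$ and $\mu[\Delta(\gamma,\delta)]$ are $\vDash_{\mathbf{Y}}$-interderivable. Here $\mu[\Gamma]$ is the union of the sets $\mu(\psi)$ for $\psi\in\Gamma$, and $\Delta[\Theta]$ is the union of the sets $\Delta(\varepsilon,\upsilon)$ for $\varepsilon\approx\upsilon$ in $\Theta$. A unary term $f(x)$ of $\mathcal{L}$ is a selector term if it is idempotent, i.e. $f(f(x))\dashv\vdash f(x)$ (each of $f(f(x))$ and $f(x)$ is derivable from the other in $\vdash$). For a formula $\chi$, $\chi[f(\overline p)/\overline p]$ is the result of substituting $f(q)$ for each variable $q$ in $\chi$; $\Gamma[f(\overline p)/\overline p]$ is defined elementwise. For $\vdash_*\in\Lambda(\vdash)$ its $\mathsf{PAt}$-$f$-variant $\vdash_*^f$ is defined by $\Gamma\vdash_*^f\phi$ iff $\Gamma[f(\overline p)/\overline p]\vdash_*\phi[f(\overline p)/\overline p]$. A $\mathsf{PAt}$-$f$-logic is a relation of the form $\vdash_*^f$ with $\vdash_*\in\Lambda(\vdash)$. For $\mathcal{A}\in\mathbf{Y}$, $\mathcal{A}^f=\{a\in A: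 f(a)=a\}$ is the set of regular elements. A polyatomic model is a pair $(\mathcal{A},v)$ with $v:\mathsf{Prop}\to\mathcal{A}^f$. $\mathcal{A},v\vDash(\Gamma,\phi)$ means: if $\mathcal{A},v\vDash\mu[\Gamma]$ then $\mathcal{A},v\vDash\mu(\phi)$. $\mathcal{A}\vDash_f(\Gamma,\phi)$ means $\mathcal{A},v\vDash(\Gamma,\phi)$ for all polyatomic models $(\mathcal{A},v)$ on $\mathcal{A}$; $\mathbf{K}\vDash_f(\Gamma,\phi)$ means $\mathcal{A}\vDash_f(\Gamma,\phi)$ for all $\mathcal{A}\in\mathbf{K}$. The $\mathsf{PAt}$-$f$-quasivariety corresponding to $\vdash_s$ is $\mathsf{QVar}^f(\vdash_s)=\{\mathcal{A}\in\mathbf{Y}:\mathcal{A}\vDash_f(\Gamma,\phi)\text{ for all }(\Gamma,\phi)\in{\vdash_s}\}$.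
   Formalization: The formal theorem also assumes that the equation f(f(x)) ≈ f(x) holds in Y; mere interderivability of f(f(x)) and f(x) is not enough (global modal logic KT with f(x) = □x is a counterexample). *)

(* Defs.v *)
From mathcomp Require Import all_boot.
From mathcomp Require Import boolp classical_sets functions cardinality filter.

Set Implicit Arguments.
Unset Strict Implicit.
Unset Printing Implicit Defensive.

Local Open Scope classical_set_scope.

(** ** Terms and algebras *)

Record language := Language { symb : Type; arity : symb -> nat }.

(* [term L X] is Tm(L, X).  Formulas have [X := nat], the fixed countably
   infinite set Prop; a unary term such as f(x) has [X := unit], and a binary
   term such as a member of Delta(x, y) has [X := bool], with [false] for x and
   [true] for y. *)
Inductive term (L : language) (X : Type) : Type :=
  | Var (x : X)
  | App (s : symb L) (args : 'I_(arity s) -> term L X).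

Arguments Var {L X} x.
Arguments App {L X} s args.

Record algebra (L : language) := Algebra {
  carrier :> Type;
  op : forall s : symb L, ('I_(arity s) -> carrier) -> carrier;
  algebra_inhabited : inhabited carrier }.

Arguments op {L} a s args.

Fixpoint eval (L : language) (X : Type) (A : algebra L) (v : X -> A)
    (t : term L X) : A :=
  match t with
  | Var x => v x
  | App s args => op A s (fun i => eval v (args i))
  end.

Definition eval1 (L : language) (A : algebra L) (t : term L unit) (a : A) : A :=
  eval (fun _ => a) t.

Definition eval2 (L : language) (A : algebra L) (t : term L bool) (a b : A) : A :=
  eval (fun i : bool => if i then b else a) t.

Arguments eval1 {L} A t a.
Arguments eval2 {L} A t a b.

Definition is_hom (L : language) (A B : algebra L) (h : A -> B) : Prop :=
  forall s args, h (op A s args) = op B s (fun i => h (args i)).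

Notation formula L := (term L nat).
Notation equation L := (formula L * formula L)%type.

(* Evaluation in the term algebra is simultaneous substitution. *)
Definition term_algebra (L : language) : algebra L :=
  @Algebra L (formula L) (fun s args => App s args) (inhabits (Var 0)).

Definition subst1 (L : language) (t : term L unit) (p : formula L) : formula L :=
  eval1 (term_algebra L) t p.

Definition subst2 (L : language) (t : term L bool) (p q : formula L) : formula L :=
  eval2 (term_algebra L) t p q.

(** ** Consequence relations and logics *)

Definition consequence (C : Type) := set C -> C -> Prop.

Definition entails_all (C : Type) (vd : consequence C) (W V : set C) : Prop :=
  forall a, V a -> vd W a.

Record is_consequence (C : Type) (vd : consequence C) : Prop := {
  conseq_refl : forall (W : set C) a, W a -> vd W a;
  conseq_cut : forall (W V : set C) a, entails_all vd W V -> vd V a -> vd W a;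
  conseq_finitary : forall (W : set C) a, vd W a ->
    exists V : set C, [/\ finite_set V, V `<=` W & vd V a] }.

Record is_logic (L : language) (vd : consequence (formula L)) : Prop := {
  logic_conseq : is_consequence vd;
  logic_subst : forall h : formula L -> formula L,
    @is_hom L (term_algebra L) (term_algebra L) h ->
    forall Gamma phi, vd Gamma phi -> vd (h @` Gamma) (h phi) }.

(* Membership in Lambda(vd). *)
Definition extension (L : language) (vd vd' : consequence (formula L)) : Prop :=
  is_logic vd' /\ forall Gamma phi, vd Gamma phi -> vd' Gamma phi.

(** ** Quasivarieties *)

Definition algebra_class (L : language) := algebra L -> Prop.

Definition isomorphic (L : language) (A B : algebra L) : Prop :=
  exists h : A -> B, is_hom h /\ bijective h.

Definition subuniverse (L : language) (A : algebra L) (S : set A) : Prop :=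
  S !=set0 /\ forall s args, (forall i, S (args i)) -> S (op A s args).

Lemma subalgebra_inhabited (L : language) (A : algebra L) (S : set A) :
  subuniverse S -> inhabited {a : A | S a}.
Proof. by move=> [[a Sa] _]; exact: inhabits (exist _ a Sa). Qed.

Definition subalgebra (L : language) (A : algebra L) (S : set A)
    (hS : subuniverse S) : algebra L :=
  @Algebra L {a : A | S a}
    (fun s args => exist _ (op A s (fun i => proj1_sig (args i)))
                     (proj2 hS s _ (fun i => proj2_sig (args i))))
    (subalgebra_inhabited hS).

Lemma product_inhabited (L : language) (I : Type) (A : I -> algebra L) :
  inhabited (forall i, A i).
Proof.
apply: inhabits => i.
by have /cid [a _] : exists a : A i, True
  by case: (algebra_inhabited (A i)) => a; exists a.
Qed.

Definition product (L : language) (I : Type) (A : I -> algebra L) : algebra L :=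
  @Algebra L (forall i, A i) (fun s args i => op (A i) s (fun j => args j i))
    (product_inhabited A).

(* The quotient of the product by a filter is described up to isomorphism, as
   a homomorphic image whose kernel is equality on a set of the filter.  [I] may
   be empty and [F] improper, so trivial algebras are reduced products. *)
Definition is_reduced_product (L : language) (I : Type) (A : I -> algebra L)
    (F : set_system I) (B : algebra L) : Prop :=
  exists h : product A -> B,
    [/\ is_hom h, forall b, exists a, h a = b &
        forall a a' : product A, h a = h a' <-> F [set i | a i = a' i]].

Record quasivariety (L : language) (Y : algebra_class L) : Prop := {
  quasivariety_iso : forall A B : algebra L, isomorphic A B -> Y A -> Y B;
  quasivariety_sub : forall (A : algebra L) (S : set A) (hS : subuniverse S),
    Y A -> Y (subalgebra hS);
  quasivariety_reduced : forall (I : Type) (A : I -> algebra L)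
      (F : set_system I) (B : algebra L),
    Filter F -> (forall i, Y (A i)) -> is_reduced_product A F B -> Y B }.

(** ** Algebraizability *)

Definition satisfies (L : language) (A : algebra L) (v : nat -> A)
    (e : equation L) : Prop :=
  eval v e.1 = eval v e.2.

Definition satisfies_all (L : language) (A : algebra L) (v : nat -> A)
    (Theta : set (equation L)) : Prop :=
  forall e, Theta e -> satisfies v e.

Definition eq_consequence (L : language) (Y : algebra_class L) :
    consequence (equation L) :=
  fun Theta e => forall A : algebra L, Y A ->
    forall v : nat -> A, satisfies_all v Theta -> satisfies v e.

Section Translations.
Context (L : language) (mu : set (term L unit * term L unit))
  (Delta : set (term L bool)).

Definition mu_at (phi : formula L) : set (equation L) :=
  [set (subst1 e.1 phi, subst1 e.2 phi) | e in mu].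

Definition mu_image (Gamma : set (formula L)) : set (equation L) :=
  \bigcup_(psi in Gamma) mu_at psi.

Definition Delta_at (gamma delta : formula L) : set (formula L) :=
  [set subst2 d gamma delta | d in Delta].

Definition Delta_image (Theta : set (equation L)) : set (formula L) :=
  \bigcup_(e in Theta) Delta_at e.1 e.2.

Record algebraizable (vd : consequence (formula L)) (Y : algebra_class L) :
    Prop := {
  alg_mu_finite : finite_set mu;
  alg_Delta_finite : finite_set Delta;
  alg_mu : forall Gamma phi, vd Gamma phi <->
    entails_all (eq_consequence Y) (mu_image Gamma) (mu_at phi);
  alg_Delta : forall Theta gamma delta,
    eq_consequence Y Theta (gamma, delta) <->
    entails_all vd (Delta_image Theta) (Delta_at gamma delta);
  alg_Delta_mu : forall phi,
    entails_all vd [set phi] (Delta_image (mu_at phi)) /\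
    vd (Delta_image (mu_at phi)) phi;
  alg_mu_Delta : forall gamma delta,
    entails_all (eq_consequence Y) [set (gamma, delta)]
      (mu_image (Delta_at gamma delta)) /\
    eq_consequence Y (mu_image (Delta_at gamma delta)) (gamma, delta) }.

End Translations.

(** ** Polyatomic logics *)

Definition selector_term (L : language) (vd : consequence (formula L))
    (f : term L unit) : Prop :=
  let x := Var 0 in
  vd [set subst1 f (subst1 f x)] (subst1 f x) /\
  vd [set subst1 f x] (subst1 f (subst1 f x)).

(* Interderivability of f(f(x)) and f(x) does not imply that the equation
   f(f(x)) = f(x) holds in the equivalent algebraic semantics: in the global
   modal logic KT, the term f(x) := []x is a selector term, but the
   equation [][]x = []x fails in some reflexive modal algebra. *)
Definition idempotent_term (L : language) (Y : algebra_class L)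
    (f : term L unit) : Prop :=
  let x := Var 0 in
  eq_consequence Y set0 (subst1 f (subst1 f x), subst1 f x).

Definition subst_vars (L : language) (f : term L unit) (chi : formula L) :
    formula L :=
  @eval L nat (term_algebra L) (fun q => subst1 f (Var q)) chi.

Definition variant (L : language) (f : term L unit)
    (vd : consequence (formula L)) : consequence (formula L) :=
  fun Gamma phi => vd (subst_vars f @` Gamma) (subst_vars f phi).

Definition PAt_logic (L : language) (vd : consequence (formula L))
    (f : term L unit) (vds : consequence (formula L)) : Prop :=
  exists2 vd', extension vd vd' & vds = variant f vd'.

Definition regular (L : language) (f : term L unit) (A : algebra L) : set A :=
  [set a | eval1 A f a = a].

Definition PAt_valid (L : language) (mu : set (term L unit * term L unit))
    (f : term L unit) (A : algebra L) (Gamma : set (formula L))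
    (phi : formula L) : Prop :=
  forall v : nat -> A, (forall p, regular f (v p)) ->
    satisfies_all v (mu_image mu Gamma) -> satisfies_all v (mu_at mu phi).

Definition PAt_class_valid (L : language)
    (mu : set (term L unit * term L unit)) (f : term L unit)
    (K : algebra_class L) (Gamma : set (formula L)) (phi : formula L) : Prop :=
  forall A : algebra L, K A -> PAt_valid mu f A Gamma phi.

Definition QVar (L : language) (mu : set (term L unit * term L unit))
    (f : term L unit) (Y : algebra_class L) (vds : consequence (formula L)) :
    algebra_class L :=
  fun A => Y A /\ forall Gamma phi, vds Gamma phi -> PAt_valid mu f A Gamma phi.

(* Main.v *)
Require Import Defs.
From mathcomp Require Import all_boot.
From mathcomp Require Import boolp classical_sets functions cardinality filter.

(** Soundness is immediate from the definition of the PAt-f-quasivariety.  For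
    completeness, write [vds] as the variant of a logic [vd'] extending [vd],
    let [sigma] be the substitution q |-> f(q), and let [T] be the set of
    [vd']-consequences of [sigma[Gamma]].  Since [T] is a theory of [vd], the
    relation Delta(gamma, delta) `<=` T is closed under the equational
    consequence of [Y]; the Lindenbaum-Tarski algebra [B] of [T] therefore lies
    in [Y] and its elements solving mu are exactly the classes of members of
    [T] ([lindenbaum_algebra]).

    The algebra [B] is in the PAt-f-quasivariety: a regular valuation is given
    by a substitution [h] such that f(h(q)) and h(q) have the same class, so
    [h (sigma chi)] and [h chi] have the same class for every [chi], and a rule
    of [vds], which is a rule of [vd'] after [sigma], remains valid after [h]
    ([lindenbaum_variant_valid]).  Finally, q |-> [f(q)] is a regular valuation
    because f is idempotent in [Y]; it sends [chi] to the class of [sigma chi],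
    hence validity of (Gamma, phi) in [B] yields that [sigma phi] is in [T].

    No ultraproduct is needed for [B] to be in [Y]: each equation outside the
    closed relation is refuted in some algebra of [Y] by a valuation satisfying
    that relation, and [B] is the subalgebra of the product of these algebras
    generated by the product valuation ([closed_equations_algebra]). *)

Set Implicit Arguments.
Unset Strict Implicit.
Unset Printing Implicit Defensive.

Local Open Scope classical_set_scope.

Section Evaluation.
Variable L : language.

Lemma eval_ext (X : Type) (A : algebra L) (v w : X -> A) (t : term L X) :
  v =1 w -> eval v t = eval w t.
Proof. by move=> /funext ->. Qed.

Lemma hom_eval (X : Type) (A B : algebra L) (h : A -> B) (v : X -> A)
    (t : term L X) :
  is_hom h -> h (eval v t) = eval (h \o v) t.
Proof.
move=> hh; elim: t => [//|s args IH] /=.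
by rewrite hh; congr op; apply: funext => i; exact: IH.
Qed.

Lemma eval_is_hom (A : algebra L) (v : nat -> A) :
  @is_hom L (term_algebra L) A (eval v).
Proof. by []. Qed.

Lemma eval_subst (X : Type) (A : algebra L) (v : nat -> A)
    (h : X -> formula L) (t : term L X) :
  eval v (@eval L X (term_algebra L) h t) = eval (fun x => eval v (h x)) t.
Proof. exact: (hom_eval _ _ (@eval_is_hom A v)). Qed.

Lemma eval_subst1 (A : algebra L) (v : nat -> A) (t : term L unit)
    (p : formula L) :
  eval v (subst1 t p) = eval1 A t (eval v p).
Proof. exact: eval_subst. Qed.

Lemma eval_subst_vars (A : algebra L) (v : nat -> A) (f : term L unit)
    (chi : formula L) :
  eval v (subst_vars f chi) = eval (fun q => eval1 A f (v q)) chi.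
Proof.
by rewrite /subst_vars eval_subst; apply: eval_ext => q; rewrite eval_subst1.
Qed.

(** The elements of [A] solving every equation of mu(x). *)
Definition solutions (mu : set (term L unit * term L unit)) (A : algebra L) :
    set A :=
  [set a | forall e, mu e -> eval1 A e.1 a = eval1 A e.2 a].

Lemma satisfies_mu_atP (mu : set (term L unit * term L unit)) (A : algebra L)
    (v : nat -> A) (chi : formula L) :
  satisfies_all v (mu_at mu chi) <-> solutions mu (eval v chi).
Proof.
split=> [H e mue|H _ [e mue <-]].
- by rewrite -!eval_subst1; apply: (H (_, _)); exists e.
- by rewrite /satisfies /= !eval_subst1; exact: H.
Qed.

Lemma satisfies_mu_imageP (mu : set (term L unit * term L unit))
    (A : algebra L) (v : nat -> A) (Gamma : set (formula L)) :
  satisfies_all v (mu_image mu Gamma) <->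
  forall psi, Gamma psi -> solutions mu (eval v psi).
Proof.
split=> [H psi Gpsi|H e [psi Gpsi mue]].
- by apply/satisfies_mu_atP => e mue; apply: H; exists psi.
- by have /satisfies_mu_atP := H _ Gpsi; apply.
Qed.

Lemma PAt_validP (mu : set (term L unit * term L unit)) (f : term L unit)
    (A : algebra L) (Gamma : set (formula L)) (phi : formula L) :
  PAt_valid mu f A Gamma phi <->
  forall v : nat -> A, (forall p, regular f (v p)) ->
    (forall psi, Gamma psi -> solutions mu (eval v psi)) ->
    solutions mu (eval v phi).
Proof.
by split=> H v rv /satisfies_mu_imageP sG; apply/satisfies_mu_atP; exact: H.
Qed.

End Evaluation.

Section Quasivariety.
Variables (L : language) (Y : algebra_class L).
Hypothesis hY : quasivariety Y.

Lemma quasivariety_product (I : Type) (A : I -> algebra L) :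
  (forall i, Y (A i)) -> Y (product A).
Proof.
move=> YA.
have FT : Filter [set [set: I]].
  split=> [//|P Q -> ->|P Q PQ PT]; first exact: setIT.
  by apply/seteqP; split=> // i _; apply: PQ; rewrite PT.
(* A direct product is the reduced product by the filter {I}. *)
apply: (quasivariety_reduced hY FT YA).
exists id; split=> [//|b|a a']; first by exists b.
split=> [->|aa']; first by apply/seteqP.
apply: functional_extensionality_dep => i.
by have : [set i | a i = a' i] i by rewrite aa'.
Qed.

Lemma range_eval_subuniverse (A : algebra L) (v : nat -> A) :
  subuniverse (range (eval v)).
Proof.
split=> [|s args argsP]; first by exists (v 0), (Var 0).
have /choice [g gE] i : exists t, eval v t = args i.
  by have [t _ tE] := argsP i; exists t.
by exists (App s g) => //=; congr op; apply: funext.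
Qed.

(** A set of equations closed under the consequence of [Y] is the set of
    equations satisfied by a generating valuation in some algebra of [Y]. *)
Lemma closed_equations_algebra (Theta : set (equation L)) :
  (forall e, eq_consequence Y Theta e -> Theta e) ->
  exists (B : algebra L) (w : nat -> B),
    [/\ Y B, forall b, exists t, eval w t = b &
        forall e, satisfies w e <-> Theta e].
Proof.
move=> ThetaC.
pose I := {e : equation L | ~ Theta e}.
have refute (i : I) : exists A : {A : algebra L & nat -> A},
    [/\ Y (projT1 A), satisfies_all (projT2 A) Theta &
        ~ satisfies (projT2 A) (proj1_sig i)].
  case: i => e /= nTe; apply: contrapT => H; apply: nTe; apply: ThetaC.
  move=> A YA v vT; apply: contrapT => nve; apply: H.
  by exists (existT (fun A : algebra L => nat -> A) A v).
have [A HA] := choice refute.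
pose P := product (fun i => projT1 (A i)).
pose u : nat -> P := fun p i => projT2 (A i) p.
have uE t i : eval u t i = eval (projT2 (A i)) t.
  by rewrite (@hom_eval _ _ P _ (fun a : P => a i)).
pose hS := range_eval_subuniverse u.
pose B := subalgebra hS.
have uS p : range (eval u) (u p) by exists (Var p).
pose w : nat -> B := fun p => exist _ (u p) (uS p).
have wE t : proj1_sig (eval w t) = eval u t.
  by rewrite (@hom_eval _ _ B P (fun b : B => proj1_sig b)).
have inj (b b' : B) : proj1_sig b = proj1_sig b' -> b = b'.
  by case: b b' => [x xS] [y yS] /= xy; exact: eq_exist.
exists B, w; split.
- apply: (quasivariety_sub hY); apply: quasivariety_product => i.
  by have [] := HA i.
- move=> b; have [t _ tE] := proj2_sig b.
  by exists t; apply: inj; rewrite wE.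
- move=> e; split=> [we|Te].
  + apply: contrapT => nTe; have [_ _] := HA (exist _ e nTe); apply.
    by rewrite /satisfies -!uE -!wE we.
  + apply: inj; rewrite !wE; apply: functional_extensionality_dep => i.
    by rewrite !uE; have [_ + _] := HA i; apply.
Qed.

End Quasivariety.

Section Lindenbaum.
Variables (L : language) (vd : consequence (formula L)) (Y : algebra_class L).
Variables (mu : set (term L unit * term L unit)) (Delta : set (term L bool)).
Hypotheses (hvd : is_logic vd) (hY : quasivariety Y).
Hypothesis halg : algebraizable mu Delta vd Y.

(** The Lindenbaum-Tarski algebra of a theory [T] of an algebraizable logic:
    it lies in [Y], it is generated by the classes of the variables, and the
    members of [T] are the formulas whose class solves mu. *)
Lemma lindenbaum_algebra (T : set (formula L)) :
  (forall chi, vd T chi -> T chi) ->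
  exists (B : algebra L) (w : nat -> B),
    [/\ Y B, forall b, exists t, eval w t = b &
        forall chi, T chi <-> solutions mu (eval w chi)].
Proof.
move=> TC; have [vdR vdT _] := logic_conseq hvd.
pose Theta : set (equation L) := [set e | Delta_at Delta e.1 e.2 `<=` T].
have ThetaC e : eq_consequence Y Theta e -> Theta e.
  case: e => g d /(alg_Delta halg) H chi /H Hchi.
  apply: TC; apply: vdT Hchi => a [e' Te' Da].
  by apply: vdR; exact: Te' Da.
have [B [w [YB gen wE]]] := closed_equations_algebra hY ThetaC.
exists B, w; split=> // chi.
have [chiD Dchi] := alg_Delta_mu halg chi.
rewrite -satisfies_mu_atP; split=> [Tchi e mue|H].
- apply/wE => a Da; apply: TC; apply: (vdT _ [set chi]).
  + by move=> _ ->; exact: vdR.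
  + by apply: chiD; exists e.
- apply: TC; apply: vdT Dchi => a [e mue Da].
  by apply: vdR; have /wE := H _ mue; apply.
Qed.

(** A Lindenbaum-Tarski algebra of a theory [T] of [vd'] validates, on regular
    valuations, every rule of the variant of [vd']. *)
Lemma lindenbaum_variant_valid (vd' : consequence (formula L))
    (f : term L unit) (T : set (formula L)) (B : algebra L) (w : nat -> B) :
  is_logic vd' -> (forall chi, vd' T chi -> T chi) ->
  (forall b, exists t, eval w t = b) ->
  (forall chi, T chi <-> solutions mu (eval w chi)) ->
  forall Sigma psi, variant f vd' Sigma psi -> PAt_valid mu f B Sigma psi.
Proof.
move=> [[vdR vdT _] vdS] TC gen TE Sigma psi Spsi; apply/PAt_validP => v rv vS.
have [g gE] := choice (fun p => gen (v p)).
pose h : formula L -> formula L := @eval L nat (term_algebra L) g.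
(* As [v] is regular, [chi] and [subst_vars f chi] have the same class
   after [h]. *)
have hE chi : eval w (h (subst_vars f chi)) = eval v chi.
  rewrite eval_subst eval_subst_vars; apply: eval_ext => q.
  by rewrite gE; exact: rv.
rewrite -hE; apply/TE; apply: TC.
apply: vdT (vdS h (@eval_is_hom _ (term_algebra L) g) _ _ Spsi).
move=> _ [_ [chi Schi <-] <-]; apply: vdR.
by apply/TE; rewrite hE; exact: vS.
Qed.

End Lindenbaum.

Theorem theorem3p26 (L : language) (vd : consequence (formula L))
    (Y : algebra_class L) (mu : set (term L unit * term L unit))
    (Delta : set (term L bool)) (f : term L unit)
    (hvd : is_logic vd) (hY : quasivariety Y)
    (halg : algebraizable mu Delta vd Y)
    (hf : selector_term vd f) (hff : idempotent_term Y f)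
    (vds : consequence (formula L)) (hvds : PAt_logic vd f vds)
    (Gamma : set (formula L)) (phi : formula L) :
  vds Gamma phi <-> PAt_class_valid mu f (QVar mu f Y vds) Gamma phi.
Proof.
split=> [H A [_ QA]|H]; first exact: QA.
have [vd' [hvd' sub] vdsE] := hvds; rewrite vdsE in H *.
have [[vdR vdT _] _] := hvd'.
pose T : set (formula L) := [set chi | vd' (subst_vars f @` Gamma) chi].
have TC' chi : vd' T chi -> T chi by apply: vdT => a.
have [B [w [YB gen TE]]] :=
  lindenbaum_algebra hvd hY halg (fun chi c => TC' chi (sub _ _ c)).
have QB : QVar mu f Y (variant f vd') B.
  by split=> //; exact: lindenbaum_variant_valid hvd' TC' gen TE.
apply/TE; rewrite eval_subst_vars.
have /PAt_validP := H B QB; apply=> [p|psi Gpsi].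
- have := hff B YB (fun=> w p); rewrite /satisfies /= !eval_subst1 /=.
  by apply=> e [].
- by rewrite -eval_subst_vars; apply/TE; apply: vdR; exists psi.
Qed.
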